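(* Let $n\ge 2$ and $p\ge 1$ be integers. The maximal value of $\sum_{i=1}^n x_i^{2p+1}$ over all $(x_1,\dots,x_n)\in\mathbb{R}^n$ subject to the constraints $\sum_{i=1}^n x_i^2=1$ and $\sum_{i=1}^n x_i=0$ is attained at the point where $$x_1=\sqrt{\frac{n-1}{n}},\qquad x_j=-\sqrt{\frac{1}{(n-1)n}}\quad (j=2,\dots,n).$$ The value of this maximum is $M_{n,2p+1}$, where $$M_{n,k}=\frac{(n-1)^{k-1}-1}{n^{k/2}(n-1)^{k/2-1}}.$$ *)

(* Defs.v *)
From mathcomp Require Import all_boot all_order all_algebra.
From mathcomp Require Import all_classical all_reals all_analysis.

Set Implicit Arguments.
Unset Strict Implicit.
Unset Printing Implicit Defensive.

Import Order.TTheory GRing.Theory Num.Theory.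
Local Open Scope ring_scope.

Definition power_sum (R : realType) (n k : nat) (x : 'rV[R]_n) : R :=
  \sum_(i < n) x 0 i ^+ k.

Definition feasible (R : realType) (n : nat) (x : 'rV[R]_n) : Prop :=
  \sum_(i < n) x 0 i ^+ 2 = 1 /\ \sum_(i < n) x 0 i = 0.

(* Indices are shifted: the distinguished coordinate x_1 has index 0 in 'I_n. *)
Definition extremal_point (R : realType) (n : nat) : 'rV[R]_n :=
  \row_(j < n)
    if val j == 0%N then Num.sqrt ((n%:R - 1) / n%:R)
    else - Num.sqrt (1 / ((n%:R - 1) * n%:R)).

(* The exponents k - 1, k / 2 and k / 2 - 1 are computed in R, hence are neither
   truncated nor rounded. *)
Definition M (R : realType) (n k : nat) : R :=
  ((n%:R - 1) `^ (k%:R - 1) - 1)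
  / (n%:R `^ (k%:R / 2) * (n%:R - 1) `^ (k%:R / 2 - 1)).

(* Main.v *)
Require Import Defs.
From mathcomp Require Import all_boot all_order all_algebra.
From mathcomp Require Import all_classical all_reals all_analysis.
From mathcomp Require Import ring lra.

Set Implicit Arguments.
Unset Strict Implicit.
Unset Printing Implicit Defensive.

Import Order.TTheory GRing.Theory Num.Theory.
Local Open Scope ring_scope.

(** Write [a] for the first coordinate of the extremal point and [- b] for the
    others, so that [a = (n - 1) b].  The bound is a linear programming
    certificate: the two constraints fix the sum over the coordinates of any
    quadratic polynomial [Q], so it suffices to find [Q] with
    [t ^+ (2 * p + 1) <= Q t] for every value [t] that a coordinate of a feasible
    point can take, with equality at [t = a] and [t = - b].  Summing over the
    coordinates then compares every feasible point with the extremal one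
    ([power_sum_le_of_quadratic]).  Coordinates of feasible points lie in
    [[- a, a]] ([feasible_coord_sqr_le]).

    For [3 <= n] the polynomial [Q] is forced: as [- b] is interior to that
    interval, [Q] has to be the Hermite interpolant of the power at [a] and,
    doubly, at [- b].
    [odd_power_le_quadratic] builds it by induction on [p]: multiplying
    [t ^+ (2 * p + 1) <= Q t] by [t ^+ 2] gives a quartic bound, and reducing
    this quartic modulo [(t + b) ^+ 2 * (t - a)] gives the next quadratic.  The
    bound survives the reduction as long as the quotient, a linear polynomial, is
    nonnegative on [[- a, a]]; this, in turn, follows from sign conditions on the
    coefficients of [Q] which the reduction preserves when [2 b <= a], that is,
    when [3 <= n].

    For [n = 2] the sign conditions fail, but there the two coordinates of a
    feasible point are opposite, so that every sum of odd powers vanishes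
    ([odd_power_sum_feasible2]). *)

(** The conditions [0 <= al] and [2 * b * al <= be] make the quotient of the
    reduction nonnegative on [[- a, a]]; [0 <= ga] is there to keep the next
    leading coefficient nonnegative.  The second condition is preserved because
    [be - 2 * b * al] is the derivative at [- b], which for the interpolant
    of an odd power is an even power times a positive constant. *)
Lemma odd_power_le_quadratic (F : realFieldType) (a b : F) (p : nat) :
  0 <= b -> 2 * b <= a ->
  exists al be ga : F,
    [/\ [/\ 0 <= al, 2 * b * al <= be & 0 <= ga],
        a ^+ (2 * p + 1) = al * a ^+ 2 + be * a + ga,
        (- b) ^+ (2 * p + 1) = al * (- b) ^+ 2 + be * (- b) + ga
      & forall t, - a <= t <= a ->
          t ^+ (2 * p + 1) <= al * t ^+ 2 + be * t + ga].
Proof.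
move=> b0 ba; have a0 : 0 <= a by lra.
elim: p => [|p [al [be [ga [[al0 beal ga0] eqa eqb leQ]]]]].
  exists 0, 1, 0; split; [by split; lra| by ring | by ring |].
  by move=> t _; rewrite le_eqVlt; apply/orP; left; apply/eqP; ring.
have expS2 (t : F) : t ^+ (2 * p.+1 + 1) = t ^+ 2 * t ^+ (2 * p + 1).
  by rewrite -exprD; congr (_ ^+ _); rewrite mulnS addnA.
(* The quotient of the reduction is [al * t + de]. *)
pose de := be + al * (a - 2 * b).
have de0 : 0 <= de by have := mulr_ge0 al0 a0; rewrite /de; lra.
pose al' := ga + al * (b * (2 * a - b)) + de * (a - 2 * b).
pose be' := al * (a * b ^+ 2) + de * (b * (2 * a - b)).
pose ga' := de * (a * b ^+ 2).
have reduce t : t ^+ 2 * (al * t ^+ 2 + be * t + ga) =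
    al' * t ^+ 2 + be' * t + ga' + (t + b) ^+ 2 * (t - a) * (al * t + de).
  by rewrite /al' /be' /ga' /de; ring.
exists al', be', ga'; split.
- have ab0 : 0 <= b * (2 * a - b) by apply: mulr_ge0 => //; lra.
  split.
  + by rewrite /al' addr_ge0 ?addr_ge0 // mulr_ge0 // subr_ge0.
  + have powb : 0 <= b ^+ 2 * (be - 2 * b * al) + 2 * (b * b ^+ (2 * p + 1)).
      by rewrite addr_ge0 // mulr_ge0 ?mulr_ge0 ?exprn_ge0 ?subr_ge0.
    rewrite exprNn -signr_odd oddD oddM /= expr1 in eqb.
    have eqb' : b ^+ (2 * p + 1) = be * b - al * b ^+ 2 - ga.
      by rewrite sqrrN in eqb; lra.
    rewrite -subr_ge0; rewrite eqb' in powb.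
    by apply: le_trans powb _; rewrite le_eqVlt; apply/orP; left; apply/eqP;
      rewrite /al' /be' /de; ring.
  + by rewrite /ga' !mulr_ge0 ?exprn_ge0.
- by rewrite expS2 eqa reduce; ring.
- by rewrite expS2 eqb reduce; ring.
- move=> t /andP[ta1 ta2]; rewrite expS2.
  apply: le_trans (_ : t ^+ 2 * (al * t ^+ 2 + be * t + ga) <= _).
    by rewrite ler_wpM2l ?sqr_ge0 // leQ // ta1.
  rewrite reduce gerDl mulr_le0_ge0 //.
    by rewrite mulr_ge0_le0 ?sqr_ge0 // subr_le0.
  have : 0 <= al * (t + a) + (be - 2 * b * al).
    by apply: addr_ge0; [apply: mulr_ge0 => //|]; lra.
  by rewrite /de => h; apply: le_trans h _; rewrite le_eqVlt; apply/orP; left;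
    apply/eqP; ring.
Qed.

Lemma feasible_sum_quadratic (R : realType) (n : nat) (x : 'rV[R]_n)
    (al be ga : R) : feasible x ->
  \sum_(i < n) (al * x 0 i ^+ 2 + be * x 0 i + ga) = al + ga *+ n.
Proof.
move=> [x2 x1]; rewrite !big_split /= -!mulr_sumr x2 x1.
by rewrite sumr_const card_ord mulr1 mulr0 addr0.
Qed.

Lemma power_sum_le_of_quadratic (R : realType) (n k : nat) (x y : 'rV[R]_n)
    (al be ga : R) : feasible x -> feasible y ->
  (forall i, x 0 i ^+ k <= al * x 0 i ^+ 2 + be * x 0 i + ga) ->
  (forall i, y 0 i ^+ k = al * y 0 i ^+ 2 + be * y 0 i + ga) ->
  power_sum k x <= power_sum k y.
Proof.
move=> fx fy lex eqy; rewrite /power_sum (eq_bigr _ (fun i _ => eqy i)).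
rewrite feasible_sum_quadratic // -(feasible_sum_quadratic al be ga fx).
exact: ler_sum.
Qed.

(** Cauchy-Schwarz for the coordinates other than [i], whose sum is [- x 0 i] and
    whose sum of squares is [1 - x 0 i ^+ 2]. *)
Lemma feasible_coord_sqr_le (R : realType) (m : nat) (x : 'rV[R]_m.+2)
    (i : 'I_m.+2) : feasible x -> m.+2%:R * x 0 i ^+ 2 <= m.+1%:R.
Proof.
move=> fx; set N : R := m.+1%:R; have N0 : 0 < N by rewrite ltr0n.
have nN : m.+2%:R = N + 1 :> R by rewrite -natr1.
(* In the case of equality the other coordinates all equal [- c]. *)
pose c := x 0 i / N; have cN : x 0 i = N * c by rewrite /c; field; lra.
have : (x 0 i + c) ^+ 2 <= \sum_j (x 0 j + c) ^+ 2.
  by rewrite (bigD1 i) //= lerDl sumr_ge0 // => j _; apply: sqr_ge0.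
have -> : \sum_j (x 0 j + c) ^+ 2 = 1 + c ^+ 2 *+ m.+2.
  rewrite -(feasible_sum_quadratic 1 (2 * c) (c ^+ 2) fx).
  by apply: eq_bigr => j _; ring.
rewrite -mulr_natr nN cN => h.
have h1 : (N + 1) * N * c ^+ 2 <= 1 by lra.
have := ler_wpM2l (ltW N0) h1; lra.
Qed.

Lemma odd_power_sum_feasible2 (R : realType) (p : nat) (x : 'rV[R]_2) :
  feasible x -> power_sum (2 * p + 1) x = 0.
Proof.
case=> + x1; rewrite /power_sum !big_ord_recl !big_ord0 !addr0 in x1 *.
have -> : x 0 (lift ord0 ord0) = - x 0 ord0 by apply/eqP; rewrite -addr_eq0 addrC x1.
by move=> _; rewrite [(- _) ^+ _]exprNn -signr_odd oddD oddM expr1 mulN1r subrr.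
Qed.

Lemma sum_extremal_point (R : realType) (m : nat) (f : R -> R) :
  let n : R := m.+2%:R in
  \sum_(i < m.+2) f (extremal_point R m.+2 0 i) =
  f (Num.sqrt ((n - 1) / n)) + f (- Num.sqrt (1 / ((n - 1) * n))) *+ m.+1.
Proof.
rewrite big_ord_recl mxE /=; congr (_ + _).
rewrite (eq_bigr (fun=> f (- Num.sqrt (1 / ((m.+2%:R - 1) * m.+2%:R))))).
  by rewrite sumr_const card_ord.
by move=> i _; rewrite mxE.
Qed.

(** The coordinates of the extremal point in terms of the square roots of [n] and
    [n - 1], in which all the sums below are Laurent polynomials. *)
Lemma extremal_point_coord (R : realType) (m : nat) :
  let n : R := m.+2%:R in
  Num.sqrt ((n - 1) / n) = Num.sqrt m.+1%:R / Num.sqrt n /\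
  Num.sqrt (1 / ((n - 1) * n)) = (Num.sqrt m.+1%:R * Num.sqrt n)^-1.
Proof.
move=> n; have -> : n - 1 = m.+1%:R by rewrite /n -natr1 addrK.
by rewrite div1r sqrtrM ?ler0n // !sqrtrV ?mulr_ge0 ?ler0n // sqrtrM ?ler0n.
Qed.

Lemma sqrt_natS (R : realType) (m : nat) :
  0 < Num.sqrt (m.+1%:R : R) /\ Num.sqrt (m.+1%:R : R) ^+ 2 = m.+1%:R.
Proof. by rewrite sqrtr_gt0 ltr0n sqr_sqrtr ?ler0n. Qed.

Lemma feasible_extremal_point (R : realType) (m : nat) :
  feasible (extremal_point R m.+2).
Proof.
have [ea eb] := extremal_point_coord R m.
have [r0 r2] := sqrt_natS R m; have [s0 s2] := sqrt_natS R m.+1.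
set r := Num.sqrt m.+1%:R in r0 r2 ea eb.
set s := Num.sqrt m.+2%:R in s0 s2 ea eb.
have s2r2 : s ^+ 2 = r ^+ 2 + 1 by rewrite s2 r2 natr1.
split.
- rewrite (sum_extremal_point m (fun t => t ^+ 2)) ea eb -mulr_natr -r2.
  have -> : (r / s) ^+ 2 + (- (r * s)^-1) ^+ 2 * r ^+ 2 = (r ^+ 2 + 1) / s ^+ 2.
    by field; rewrite !gt_eqF.
  by rewrite -s2r2 divff // expf_neq0 // gt_eqF.
- rewrite (sum_extremal_point m id) ea eb -mulr_natr -r2.
  by field; rewrite !gt_eqF.
Qed.

Lemma power_sum_extremal_point (R : realType) (m p : nat) : (1 <= p)%N ->
  power_sum (2 * p + 1) (extremal_point R m.+2) = M R m.+2 (2 * p + 1).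
Proof.
case: p => // q _.
have [ea eb] := extremal_point_coord R m.
have [r0 r2] := sqrt_natS R m; have [s0 s2] := sqrt_natS R m.+1.
rewrite /power_sum (sum_extremal_point m (fun t => t ^+ (2 * q.+1 + 1))) ea eb.
have nN : m.+2%:R - 1 = m.+1%:R :> R by rewrite -natr1 addrK.
have powR_half (N k : nat) : N%:R `^ (k%:R / 2) = Num.sqrt N%:R ^+ k :> R.
  by rewrite mulrC powRrM powR12_sqrt ?ler0n // powR_mulrn // sqrtr_ge0.
have e1 : (2 * q.+1 + 1)%:R - 1 = (2 * q.+1)%:R :> R by rewrite natrD addrK.
have e2 : (2 * q.+1 + 1)%:R / 2 - 1 = (2 * q + 1)%:R / 2 :> R.
  by rewrite !natrD !natrM -natr1; field.
rewrite /M nN e1 e2 !powR_half powR_mulrn ?ler0n //.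
set r := Num.sqrt m.+1%:R in r0 r2 *; set s := Num.sqrt m.+2%:R in s0 *.
rewrite -[in LHS]mulr_natr -r2.
rewrite [(- _) ^+ _]exprNn -signr_odd oddD oddM expr1.
rewrite -exprM expr_div_n exprVn [(r * s) ^+ _]exprMn.
have -> : (2 * (2 * q.+1) = (2 * q + 1) + (2 * q + 1) + 2)%N by ring.
have -> : r ^+ (2 * q.+1 + 1) = r ^+ (2 * q + 1) * r ^+ 2.
  by rewrite -exprD; congr (_ ^+ _); ring.
rewrite (exprD r _ 2) (exprD r (2 * q + 1) (2 * q + 1)).
have : r ^+ (2 * q + 1) != 0 by rewrite expf_neq0 // gt_eqF.
have : s ^+ (2 * q.+1 + 1) != 0 by rewrite expf_neq0 // gt_eqF.
move: (_ ^+ (2 * q + 1)) (_ ^+ (2 * q.+1 + 1)) => u v v0 u0.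
by field; rewrite u0 v0 gt_eqF.
Qed.

Lemma power_sum_le_extremal_point (R : realType) (m p : nat) (x : 'rV[R]_m.+2) :
  feasible x ->
  power_sum (2 * p + 1) x <= power_sum (2 * p + 1) (extremal_point R m.+2).
Proof.
move=> fx; have fe := feasible_extremal_point R m.
case: m => [|m] in x fx fe *; first by rewrite !odd_power_sum_feasible2.
have [ea eb] := extremal_point_coord R m.+1.
have [r0 r2] := sqrt_natS R m.+1; have [s0 s2] := sqrt_natS R m.+2.
set r := Num.sqrt _ in r0 r2 ea eb; set s := Num.sqrt _ in s0 s2 ea eb.
have a0 : 0 <= r / s by rewrite divr_ge0 // ltW.
have b0 : 0 <= (r * s)^-1 by rewrite invr_ge0 mulr_ge0 // ltW.
have ab : r / s = m.+2%:R * (r * s)^-1 by rewrite -r2; field; rewrite !gt_eqF.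
have ba : 2 * (r * s)^-1 <= r / s by rewrite ab ler_wpM2r // ler_nat.
have [al [be [ga [_ eqa eqb leQ]]]] := odd_power_le_quadratic p b0 ba.
apply: (power_sum_le_of_quadratic fx fe (al := al) (be := be) (ga := ga)) => i.
  apply: leQ; rewrite -ler_norml -(@ler_pXn2r _ 2) ?nnegrE //.
  rewrite real_normK ?num_real // expr_div_n r2 s2 ler_pdivlMr ?ltr0n // mulrC.
  exact: feasible_coord_sqr_le.
by rewrite mxE; case: ifP => _; rewrite ?ea ?eb.
Qed.

Theorem theorem3 (R : realType) (n p : nat) (hn : (2 <= n)%N) (hp : (1 <= p)%N) :
  [/\ feasible (extremal_point R n),
      forall x : 'rV[R]_n, feasible x ->
        power_sum (2 * p + 1) x <= power_sum (2 * p + 1) (extremal_point R n)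
    & power_sum (2 * p + 1) (extremal_point R n) = M R n (2 * p + 1)].
Proof.
case: n hn => [|[|m]] // _; split.
- exact: feasible_extremal_point.
- exact: power_sum_le_extremal_point.
- exact: power_sum_extremal_point.
Qed.
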